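(* Let $n,k$ be integers with $1\le k\le n$. Then \[ E(2n,k)=\frac1{2^{2(k-1)}}\binom{2k-1}{k}\zeta(2n)-\sum_{j=1}^{\lfloor \frac{k-1}2\rfloor}\frac1{2^{2k-3}(2j+1)B_{2j}}\binom{2k-2j-1}{k}\zeta(2j)\zeta(2n-2j). \]
   Context: For positive integers $i_1,\dots,i_k$ with $i_1>1$, the multiple zeta value is $\zeta(i_1,\dots,i_k)=\sum_{n_1>\dots>n_k\ge 1} n_1^{-i_1}\cdots n_k^{-i_k}$; it has weight $i_1+\dots+i_k$ and depth $k$. For $1\le k\le n$, $E(2n,k)$ denotes the sum of $\zeta(i_1,\dots,i_k)$ over all $k$-tuples $(i_1,\dots,i_k)$ of positive even integers with $i_1+\dots+i_k=2n$. $\zeta(m)$ is the Riemann zeta value, and $B_m$ are the Bernoulli numbers defined by $x/(e^x-1)=\sum_{m\ge0}B_m x^m/m!$ (so $B_0=1$, $B_2=1/6$). *)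

(* Defs.v *)
From HB Require Import structures.
From mathcomp Require Import all_boot all_order all_algebra.
From mathcomp Require Import all_classical all_reals all_analysis.
Import Order.TTheory GRing.Theory Num.Theory.
Import numFieldNormedType.Exports.

Local Open Scope classical_set_scope.
Local Open Scope ring_scope.
Local Open Scope ereal_scope.

(* The summation indices n_1 > ... > n_k >= 1, numbered from 0. *)
Definition mzv_index (k : nat) : set {ffun 'I_k -> nat} :=
  [set n : {ffun 'I_k -> nat} | (forall a : 'I_k, 0 < n a)%N /\
           (forall a b : 'I_k, a < b -> n b < n a)%N].

(* Nonnegative series are summed in \bar R: the value is +oo exactly when the
   series diverges, so an equation with a finite value includes convergence. *)
Definition mzv (R : realType) {k : nat} (i : 'I_k -> nat) : \bar R :=
  \esum_(n in mzv_index k) (\prod_(a < k) (n a)%:R ^- i a)%:E.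

Definition zeta (R : realType) (m : nat) : \bar R :=
  \sum_(1 <= n <oo) (n%:R ^- m)%:E.

(* Entries are at most the weight m, so ranging over 'I_m.+1 loses no tuple. *)
Definition even_mzv_sum (R : realType) (m k : nat) : \bar R :=
  \sum_(i : {ffun 'I_k -> 'I_m.+1} |
         [forall a, (0 < i a)%N && ~~ odd (i a)]
         && ((\sum_(a < k) i a)%N == m))
    mzv R (fun a => i a : nat).

(* x / (e^x - 1) = \sum_m B_m x^m / m! for all small x <> 0 (0^' is the filter
   of punctured neighbourhoods of 0); this determines B. *)
Definition bernoulli_numbers {R : realType} (B : nat -> R) : Prop :=
  \forall x \near (0%R : R)^',
    series (fun m => B m * x ^+ m / m`!%:R)%R @ \oo --> (x / (expR x - 1))%R.

(* Main.v *)
Require Import Defs.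
From HB Require Import structures.
From mathcomp Require Import all_boot all_order all_algebra.
From mathcomp Require Import all_classical all_reals all_analysis.
From mathcomp Require Import ring lra zify.
Import Order.TTheory GRing.Theory Num.Theory.
Import numFieldNormedType.Exports.
Local Open Scope classical_set_scope.
Local Open Scope ring_scope.

(* Let G_k(t) = \sum_n E(2n,k) t^n and Z = G_1 = \sum_n zeta(2n) t^n. Since
   \sum_k G_k s^k is the product over i of 1 + s t i^-2 / (1 - t i^-2), its
   logarithmic derivatives in s and t give
     (k + 1) G_{k+1} = Z G_k - t G_k' + k G_k,
   so all G_k are determined by the zeta(2n). Euler's identity
     \sum_(0 < j < n) zeta(2j) zeta(2n-2j) = (n + 1/2) zeta(2n)   (n >= 2)
   computes G_2, and induction on k turns it into the three-term recurrence
     4 (k+1) (k+2) G_{k+2} = (4k+6) (k+1) G_{k+1} - 6 zeta(2) t G_k,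
   whose solution is
     E(2n,k) = \sum_j (-24 zeta(2))^j / (4^(k-1) (2j+1)!) C(2k-2j-1,k) zeta(2n-2j).
   The numbers B_2n / (2n)! satisfy the same quadratic recurrence as the
   zeta(2n), up to scaling, whence
     zeta(2j) = - (-24 zeta(2))^j B_2j / (2 (2j)!),
   which replaces the powers of zeta(2) by zeta(2j) / B_2j. *)

(** * Recurrences *)

(* On generating functions, G |-> P G - t G' with P = \sum_j p j t^j. *)
Definition log_op {R : numFieldType} (p g : nat -> R) (n : nat) : R :=
  \sum_(j < n.+1) p j * g (n - j)%N - n%:R * g n.

(* For p j = \sum_x x^j, evsum p k n is the sum of the monomial symmetric
   functions of the x's over the partitions of n into k parts: multiplying such
   a monomial by x^j either introduces a new variable or raises an exponent,
   which gives (k + 1) G_{k+1} = P G_k - t G_k' + k G_k. *)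
Fixpoint evsum {R : numFieldType} (p : nat -> R) (k n : nat) : R :=
  if k is k'.+1 then
    (log_op p (evsum p k') n + k'%:R * evsum p k' n) / k%:R
  else (n == 0)%:R.

Lemma evsumS {R : numFieldType} (p : nat -> R) k n :
  k.+1%:R * evsum p k.+1 n = log_op p (evsum p k) n + k%:R * evsum p k n.
Proof. by rewrite mulrC divfK // pnatr_eq0. Qed.

Lemma evsum1 {R : numFieldType} (p : nat -> R) n : evsum p 1 n = p n.
Proof.
rewrite /= /log_op mul0r addr0 divr1 big_ord_recr /= subnn mulr1 big1 => [|j _].
  by case: n => [|n]; rewrite ?mul0r ?mulr0 subr0 add0r.
by rewrite subn_eq0 leqNgt ltn_ord mulr0.
Qed.

(** Multiplication by t on generating functions. *)
Definition seq_shift {R : numFieldType} (g : nat -> R) (n : nat) : R :=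
  if n is n'.+1 then g n' else 0.

Lemma log_op_lin {R : numFieldType} (p g h : nat -> R) (a b : R) n :
  log_op p (fun m => a * g m + b * h m) n = a * log_op p g n + b * log_op p h n.
Proof.
rewrite /log_op.
have -> : \sum_(j < n.+1) p j * (a * g (n - j)%N + b * h (n - j)%N) =
   a * \sum_(j < n.+1) p j * g (n - j)%N + b * \sum_(j < n.+1) p j * h (n - j)%N.
  rewrite !mulr_sumr -big_split /=; apply: eq_bigr => j _; ring.
ring.
Qed.

Lemma eq_log_op {R : numFieldType} (p g h : nat -> R) n :
  g =1 h -> log_op p g n = log_op p h n.
Proof.
by move=> gh; rewrite /log_op gh; congr (_ - _); apply: eq_bigr => j _; rewrite gh.
Qed.

(** Leibniz rule: t (t G)' = t (t G') + t G. *)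
Lemma log_op_shift {R : numFieldType} (p g : nat -> R) n :
  log_op p (seq_shift g) n = seq_shift (log_op p g) n - seq_shift g n.
Proof.
case: n => [|n]; first by rewrite /log_op big_ord1 mulr0 mul0r.
rewrite /log_op big_ord_recr /= subnn mulr0 addr0 -natr1.
under eq_bigr => j _ do rewrite (subSn (ltn_ord j : (j <= n)%N)) /=.
ring.
Qed.

(* The case k = 0 is Euler's identity; the operator log_op carries the relation
   from k to k + 1. *)
Lemma evsum_rec {R : numFieldType} (p : nat -> R) :
  p 0 = 0 ->
  (forall n, (1 < n)%N -> \sum_(j < n.+1) p j * p (n - j)%N = (n%:R + 2^-1) * p n) ->
  forall k n, 4 * k.+1%:R * k.+2%:R * evsum p k.+2 n =
     (4 * k%:R + 6) * k.+1%:R * evsum p k.+1 n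
     - 6 * p 1 * seq_shift (evsum p k) n.
Proof.
move=> p0 euler; elim=> [|k IHk] n.
  have := evsumS p 1 n; rewrite (eq_log_op p _ p) ?evsum1; last first.
    by move=> m; rewrite evsum1.
  rewrite /log_op => E2.
  have -> : 4 * 1 * 2 * evsum p 2 n = 4 * (2 * evsum p 2 n) by ring.
  rewrite E2; case: n E2 => [|[|n]] _ /=.
  - by rewrite big_ord1 p0; ring.
  - by rewrite !big_ord_recl big_ord0 /= p0 /=; ring.
  - by rewrite euler //; field.
have Lrec m : log_op p (evsum p k.+1) m = k.+2%:R * evsum p k.+2 m - k.+1%:R * evsum p k.+1 m.
  by rewrite (evsumS p k.+1); ring.
have H : log_op p (fun m => 4 * k.+1%:R * k.+2%:R * evsum p k.+2 m) n =
   log_op p (fun m => (4 * k%:R + 6) * k.+1%:R * evsum p k.+1 m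
     + (- (6 * p 1)) * seq_shift (evsum p k) m) n.
  by apply: eq_log_op => m; rewrite IHk; ring.
have H1 : log_op p (fun m => 4 * k.+1%:R * k.+2%:R * evsum p k.+2 m) n =
   4 * k.+1%:R * k.+2%:R * (k.+3%:R * evsum p k.+3 n - k.+2%:R * evsum p k.+2 n).
  (* Linearity with a zero second summand pulls the scalar out of [log_op]. *)
  rewrite (evsumS p k.+2) addrK -[RHS]addr0 -[in RHS](mul0r (log_op p (fun=> 0) n)).
  by rewrite -log_op_lin; apply: eq_log_op => m; rewrite mul0r addr0.
move: H; rewrite H1 log_op_lin log_op_shift Lrec => H.
have S : seq_shift (log_op p (evsum p k)) n = k.+1%:R * seq_shift (evsum p k.+1) n - k%:R * seq_shift (evsum p k) n.
  case: (n) => [|m]; first by rewrite !mulr0 subr0.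
  by rewrite /seq_shift evsumS; ring.
move: H; rewrite S => H.
have k1 : k.+1%:R != 0 :> R by rewrite pnatr_eq0.
apply: (mulfI k1).
have I := IHk n.
have e1 : k.+1%:R = k%:R + 1 :> R by rewrite -natr1.
have e2 : k.+2%:R = k%:R + 2 :> R by rewrite -addn2 natrD.
have e3 : k.+3%:R = k%:R + 3 :> R by rewrite -addn3 natrD.
move: H I; rewrite e1 e2 e3.
move: (evsum p k.+3 n) (evsum p k.+2 n) (evsum p k.+1 n) (seq_shift (evsum p k.+1) n) (seq_shift (evsum p k) n) (p 1) (k%:R : R).
move=> g3 g2 g1 s1 s0 q K H I.
(* Applying [log_op] left a multiple of t G_k; the induction hypothesis at the same n eliminates
   it. *)
have : 6 * q * s0 = (4 * K + 6) * (K + 1) * g1 - 4 * (K + 1) * (K + 2) * g2 by rewrite I; ring.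
move=> I'.
have -> : (K + 1) * (4 * (K + 2) * (K + 3) * g3) =
  4 * (K + 1) * (K + 2) * ((K + 3) * g3 - (K + 2) * g2) + 4 * (K + 1) * (K + 2) * (K + 2) * g2 by ring.
rewrite H.
have -> : - (6 * q) * ((K + 1) * s1 - K * s0 - s0) = - (6 * q) * (K + 1) * s1 + (K + 1) * (6 * q * s0) by ring.
rewrite I'; ring.
Qed.

(** Coefficient of zeta(2n-2j) in E(2n,k) when c = 6 zeta(2). For k > 0 the binomial vanishes as
    soon as 2j >= k. *)
Definition evcoef {R : numFieldType} (c : R) (k j : nat) : R :=
  (- (4 * c)) ^+ j * 'C(2 * k - 2 * j - 1, k)%:R / (4 ^+ (k - 1) * (2 * j + 1)`!%:R).

Lemma bin_absorb {R : numFieldType} a k :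
  k.+1%:R * 'C(a, k.+1)%:R = (a%:R - k%:R) * 'C(a, k)%:R :> R.
Proof.
case: (leqP k a) => ka.
  by rewrite -natrB // -!natrM mul_bin_left.
by rewrite !bin_small // ?mulr0 // ltnW.
Qed.

(** With a = 2k + 1 - 2j, two Pascal steps expand the left side over C(a,k), C(a,k+1), C(a,k+2), and
    absorption reduces everything to C(a,k); then 2j = 2k + 1 - a makes the two sides agree. *)
Lemma bin_rec {R : numFieldType} (k j : nat) : (j <= k)%N ->
  (k.+1%:R * k.+2%:R * 'C(2 * k.+2 - 2 * j - 1, k.+2)%:R : R) =
  (4 * k%:R + 6) * k.+1%:R * 'C(2 * k.+1 - 2 * j - 1, k.+1)%:R
  + (2 * j)%:R * (2 * j + 1)%:R * 'C(2 * k.+1 - 2 * j - 1, k)%:R.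
Proof.
move=> jk.
have -> : (2 * k.+2 - 2 * j - 1 = (2 * k.+1 - 2 * j - 1).+2)%N by lia.
have aE : (2 * j)%:R = 2 * k%:R + 1 - (2 * k.+1 - 2 * j - 1)%:R :> R.
  apply/eqP; rewrite eq_sym subr_eq -!natrM -natrD -[1]/(1%:R) -natrD; apply/eqP.
  by congr (_%:R); lia.
rewrite natrD aE !binS !natrD.
move: (2 * k.+1 - 2 * j - 1)%N => a.
have h1 := @bin_absorb R a k; have h2 := @bin_absorb R a k.+1.
move: h1 h2; rewrite -(natr1 k.+1) -(natr1 k).
move: ('C(a, k)%:R : R) ('C(a, k.+1)%:R : R) ('C(a, k.+2)%:R : R) (k%:R : R) (a%:R : R).
move=> c0 c1 c2 K A h1 h2.
have -> : (K + 1) * (K + 1 + 1) * (c2 + c1 + (c1 + c0)) =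
  (K + 1) * ((K + 1 + 1) * c2) + 2 * (K + 2) * ((K + 1) * c1) + (K + 1) * (K + 2) * c0 by ring.
rewrite h2.
have -> : (K + 1) * ((A - (K + 1)) * c1) = (A - (K + 1)) * ((K + 1) * c1) by ring.
have -> : (4 * K + 6) * (K + 1) * c1 = (4 * K + 6) * ((K + 1) * c1) by ring.
rewrite h1; ring.
Qed.

(** The recurrence of [evsum_rec] read off at p (n - j): multiplication by t moves index i to j = i
    + 1. *)
Lemma evcoef_rec {R : numFieldType} (c : R) (k j : nat) : (j <= k)%N ->
  4 * k.+1%:R * k.+2%:R * evcoef c k.+2 j =
  (4 * k%:R + 6) * k.+1%:R * evcoef c k.+1 j
  - (if j is i.+1 then c * (if k is 0 then 0 else evcoef c k i) else 0).
Proof.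
move=> jk; rewrite /evcoef !subn1 /=.
have f0 : (2 * j + 1)`!%:R != 0 :> R by rewrite pnatr_eq0 -lt0n fact_gt0.
have p0 : 4 ^+ k != 0 :> R by rewrite expf_neq0 // pnatr_eq0.
have := @bin_rec R k j jk; rewrite !subn1 => H.
have -> : 4 * k.+1%:R * k.+2%:R *
   ((- (4 * c)) ^+ j * 'C((2 * k.+2 - 2 * j).-1, k.+2)%:R / (4 ^+ k.+1 * (2 * j + 1)`!%:R))
   = (- (4 * c)) ^+ j * (k.+1%:R * k.+2%:R * 'C((2 * k.+2 - 2 * j).-1, k.+2)%:R) / (4 ^+ k * (2 * j + 1)`!%:R).
  by rewrite exprS; field; rewrite p0 f0.
rewrite H; case: j jk f0 {H} => [|i] ik f0.
  rewrite muln0 mul0r; field; by rewrite p0 f0.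
case: k ik p0 => [//|k] ik p0.
rewrite !subn1 (_ : (2 * k.+1 - 2 * i).-1 = (2 * k.+2 - 2 * i.+1).-1); last by lia.
have g0 : (2 * i + 1)`!%:R != 0 :> R by rewrite pnatr_eq0 -lt0n fact_gt0.
have q0 : 4 ^+ k != 0 :> R by rewrite expf_neq0 // pnatr_eq0.
(* The factor 2j (2j + 1) from [bin_rec] is the quotient (2j + 1)! / (2j - 1)!, with j = i + 1. *)
have eF : (2 * i.+1 + 1)`!%:R = (2 * i.+1 + 1)%:R * (2 * i.+1)%:R * (2 * i + 1)`!%:R :> R.
  have -> : (2 * i.+1 + 1 = (2 * i + 1).+2)%N by lia.
  have -> : (2 * i.+1 = (2 * i + 1).+1)%N by lia.
  by rewrite !factS !natrM mulrA.
have a0 : (2 * i.+1 + 1)%:R != 0 :> R by rewrite pnatr_eq0; lia.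
have b0 : (2 * i.+1)%:R != 0 :> R by rewrite pnatr_eq0; lia.
rewrite eF.
move: ((2 * i + 1)`!%:R : R) ((2 * i.+1 + 1)%:R : R) ((2 * i.+1)%:R : R) g0 a0 b0 => f a b g0 a0 b0.
by rewrite /= !exprS; field; rewrite q0 a0 b0 g0.
Qed.

(** Two-step induction on k along [evsum_rec]. The bound k <= n survives the shift: k + 2 <= n gives
    k <= n - 1. *)
Lemma evsum_closed {R : numFieldType} (p : nat -> R) :
  p 0 = 0 ->
  (forall n, (1 < n)%N -> \sum_(j < n.+1) p j * p (n - j)%N = (n%:R + 2^-1) * p n) ->
  forall k n, (0 < k <= n)%N ->
    evsum p k n = \sum_(j < k) evcoef (6 * p 1) k j * p (n - j)%N.
Proof.
move=> p0 euler k; have [K] := ubnP k.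
elim: K k => // K IHK [//|[|k]] kK n /andP[_ kn].
  rewrite evsum1 big_ord1 subn0 (_ : evcoef _ 1 0 = 1) ?mul1r // /evcoef.
  by rewrite expr0 mul1r divff // pnatr_eq0.
have c0 : 4 * k.+1%:R * k.+2%:R != 0 :> R by rewrite !mulf_neq0 ?pnatr_eq0.
apply: (mulfI c0); rewrite evsum_rec // IHK; [|lia|lia].
case: n kn => // n kn; rewrite /seq_shift.
(* For k = 0 the sum is empty, and [evsum p 0 n] vanishes because n > 0 here. *)
have -> : evsum p k n = \sum_(j < k) evcoef (6 * p 1) k j * p (n - j)%N.
  case: k kn kK {c0} => [|k] kn kK; last by apply: IHK; lia.
  by rewrite big_ord0; case: n kn.
(* Dropping j = k + 1, whose binomial is 0, leaves j <= k, the range of [evcoef_rec]. *)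
rewrite [in RHS]big_ord_recr /=.
have -> : evcoef (6 * p 1) k.+2 k.+1 = 0.
  by rewrite /evcoef bin_small ?mulr0 ?mul0r //; lia.
rewrite mul0r addr0 mulr_sumr [RHS]mulr_sumr.
under [RHS]eq_bigr => j _ do rewrite mulrA (@evcoef_rec R _ k j (ltn_ord j : (j <= k)%N)) mulrBl.
rewrite [RHS]sumrB; congr (_ - _).
  by apply: eq_bigr => j _; rewrite mulrA.
rewrite big_ord_recl mul0r add0r mulr_sumr; apply: eq_bigr => j _ /=.
rewrite subSS; case: (k) j => [[]//|k' j]; ring.
Qed.

(** * Symmetric functions of geometric series *)

Fixpoint elem_sym {A : nzRingType} (s : seq A) (k : nat) : A :=
  match k, s with
  | 0, _ => 1
  | k'.+1, [::] => 0
  | k'.+1, u :: s' => elem_sym s' k'.+1 + u * elem_sym s' k'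
  end.

Lemma elem_sym0 {A : nzRingType} (s : seq A) : elem_sym s 0 = 1.
Proof. by case: s. Qed.

Lemma elem_sym1 {A : nzRingType} (s : seq A) : elem_sym s 1 = \sum_(u <- s) u.
Proof.
elim: s => [|u s IHs]; first by rewrite big_nil.
by rewrite big_cons -IHs /= elem_sym0 mulr1 addrC.
Qed.

(** Let F be the product of the 1 + s u. The claim is dF/ds + X F' = (sum of the u) F + s dF/ds
    modulo X^M; after division by F, each factor contributes u/(1 + s u) + s (u + u^2)/(1 + s u) = u
    + s u/(1 + s u). *)
Lemma elem_sym_deriv {A : comNzRingType} (M : nat) (s : seq {poly A}) :
  (forall u, u \in s -> exists r, 'X * u^`() = u + u ^+ 2 + r * 'X^M) ->
  forall k, exists r, k.+1%:R * elem_sym s k.+1 + 'X * (elem_sym s k)^`()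
     = (\sum_(u <- s) u) * elem_sym s k + k%:R * elem_sym s k + r * 'X^M.
Proof.
elim: s => [|u s IHs] us k.
  exists 0; rewrite big_nil; case: k => [|k] /=.
    by rewrite -(polyC1 A) derivC; ring.
  by rewrite deriv0; ring.
have {}IHs := IHs (fun v vs => us v (mem_behead (s := u :: s) vs)).
have [ru Hu] := us u (mem_head _ _).
case: k => [|k].
  exists 0; rewrite elem_sym1 elem_sym0 -(polyC1 A) derivC polyC1; ring.
have [r1 H1] := IHs k.+1; have [r0 H0] := IHs k.
exists (r1 + u * r0 + ru * elem_sym s k).
have eS j : elem_sym (u :: s) j.+1 = elem_sym s j.+1 + u * elem_sym s j by [].
rewrite big_cons !eS derivD derivM.
move: H1 H0 Hu; rewrite -!(natr1 (_.+1)) -!(natr1 k).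
move: (elem_sym s k.+2) (elem_sym s k.+1) (elem_sym s k) => e2 e1 e0 H1 H0 Hu.
have -> : (k%:R + 1 + 1) * (e2 + u * e1) + 'X * (e1^`() + (u^`() * e0 + u * e0^`())) =
  ((k%:R + 1 + 1) * e2 + 'X * e1^`()) + u * ((k%:R + 1) * e1 + 'X * e0^`()) + u * e1 + 'X * u^`() * e0.
  ring.
rewrite H1 H0 Hu; ring.
Qed.

(** Below degree M the error of [elem_sym_deriv] is invisible, and what remains is the recursion
    defining [evsum]. *)
Lemma elem_sym_evsum {R : numFieldType} (M : nat) (s : seq {poly R}) :
  (forall u, u \in s -> exists r, 'X * u^`() = u + u ^+ 2 + r * 'X^M) ->
  forall k n, (n < M)%N ->
    (elem_sym s k)`_n = evsum (fun j => (\sum_(u <- s) u)`_j) k n.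
Proof.
move=> us; elim=> [|k IHk] n nM; first by case: s {us} => [|u s]; rewrite /= coef1.
have [r H] := elem_sym_deriv M s us k.
have k0 : k.+1%:R != 0 :> R by rewrite pnatr_eq0.
apply: (mulfI k0); rewrite evsumS /log_op -IHk //.
have := congr1 (fun p : {poly R} => p`_n) H.
rewrite !coefD coefXM -!polyC_natr !coefCM coefMXn nM addr0 coefM.
under [in X in _ -> _ = X]eq_bigr => j _.
  rewrite -IHk; last by rewrite (leq_ltn_trans (leq_subr _ _)).
  over.
have -> : (if n == 0 then 0 else (elem_sym s k)^`()`_n.-1) = n%:R * (elem_sym s k)`_n.
  by case: n nM {H} => [|n] _ /=; rewrite ?mul0r // coef_deriv mulr_natl.
by move=> /(canRL (addrK _)) ->; ring.
Qed.

(** Truncation modulo X^M of y / (1 - y), where y = x X. *)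
Definition geom_poly {A : nzRingType} (M : nat) (x : A) : {poly A} :=
  \poly_(j < M) (if j == 0 then 0 else x ^+ j).

(** For y = x X, the series u = y / (1 - y) satisfies X u' = y / (1 - y)^2 = u + u^2; the truncated
    version comes from differentiating (1 - y) G = 1 - y^M. *)
Lemma geom_poly_deriv {A : comNzRingType} (M : nat) (x : A) : (0 < M)%N ->
  exists r, 'X * (geom_poly M x)^`() =
            geom_poly M x + geom_poly M x ^+ 2 + r * 'X^M.
Proof.
move=> M0; set y := x *: 'X : {poly A}.
have yM : y ^+ M = (x ^+ M)%:P * 'X^M by rewrite /y exprZn mul_polyC.
have GE : geom_poly M x = \sum_(j < M) y ^+ j - 1.
  rewrite /geom_poly poly_def; case: M M0 {yM} => // M _.
  rewrite !big_ord_recl /= scale0r expr0 add0r (addrC 1) addrK.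
  by apply: eq_bigr => j _; rewrite /y exprZn.
have H : (1 - y) * \sum_(j < M) y ^+ j = 1 - y ^+ M.
  by rewrite -[in RHS](expr1n _ M) subrXX; congr (_ * _);
     apply: eq_bigr => j _; rewrite expr1n mul1r.
have Hd := congr1 (fun p : {poly A} => 'X * p^`()) H.
move: Hd; rewrite /= derivM !derivB deriv_exp -(polyC1 A) derivC /y derivZ derivX alg_polyC -/y.
rewrite GE derivB -(polyC1 A) derivC polyC1.
move: H; move: (\sum_(j < M) y ^+ j) => G H.
have XyE : x%:P * 'X = y by rewrite mul_polyC.
have dyE : 'X * (x%:P * y ^+ M.-1 *+ M) = M%:R * y ^+ M.
  have -> : y ^+ M = x%:P * 'X * y ^+ M.-1 by rewrite XyE -exprS prednK.
  by rewrite -mulr_natl; ring.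
move=> Hd.
have e1 : (1 - y) * ('X * G^`()) = y * G - M%:R * y ^+ M.
  have -> : (1 - y) * ('X * G^`()) =
      'X * ((0 - x%:P) * G + (1 - y) * G^`()) + x%:P * 'X * G by ring.
  by rewrite Hd XyE -dyE; ring.
(* Instead of dividing by 1 - y, multiply by [G]: this turns 1 - y into 1 - y^M, which is 1 up to a
   multiple of X^M. *)
have e2 : (1 - y ^+ M) * ('X * G^`()) = (G - 1 + y ^+ M) * G - M%:R * y ^+ M * G.
  have -> : (1 - y ^+ M) * ('X * G^`()) = G * ((1 - y) * ('X * G^`())) by rewrite -H; ring.
  rewrite e1.
  have -> : G - 1 + y ^+ M = y * G by rewrite -[y ^+ M](subKr 1) -H; ring.
  ring.
exists ((x ^+ M)%:P * ('X * G^`() + G - M%:R * G)); rewrite subr0.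
rewrite [LHS](_ : _ = (1 - y ^+ M) * ('X * G^`()) + y ^+ M * ('X * G^`())); last by ring.
rewrite e2 yM; ring.
Qed.

(** * Bernoulli numbers *)

Lemma poly_eq_modXn {A : nzRingType} (M : nat) (p q : {poly A}) :
  (forall j, (j < M)%N -> p`_j = q`_j) -> exists r, p = q + r * 'X^M.
Proof.
move=> pq; exists (drop_poly M (p - q)).
rewrite -[LHS](subrKC q); congr (_ + _); rewrite -[LHS](poly_take_drop M).
rewrite [X in X + _](_ : _ = 0) ?add0r //; apply/polyP => j.
by rewrite coef_take_poly coefB coef0; case: ifP => // /pq ->; rewrite subrr.
Qed.

(* f = x/(e^x - 1) satisfies x f' = f - f^2 - x f. *)
Lemma bernoulli_riccati {R : numFieldType} (b : nat -> R) :
  (forall m, \sum_(j < m.+1) b j / (m - j).+1`!%:R = (m == 0)%:R) ->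
  forall m, m%:R * b m = b m - \sum_(j < m.+1) b j * b (m - j)%N
                         - (if m is m'.+1 then b m' else 0).
Proof.
move=> bE m; set M := m.+1.
(* Truncations of x/(e^x - 1) and of (e^x - 1)/x. *)
pose P := \poly_(j < M) b j; pose Q : {poly R} := \poly_(j < M) j.+1`!%:R^-1.
have [r HPQ] : exists r, P * Q = 1 + r * 'X^M.
  apply: poly_eq_modXn => j jM; rewrite coefM coef1 -bE; apply: eq_bigr => i _.
  have ij : (i <= j)%N := ltn_ord i.
  by rewrite !coef_poly (leq_ltn_trans ij jM) (leq_ltn_trans (leq_subr _ _) jM).
(* Derivative of x Q = e^x - 1, whose right side has derivative 1 + x Q. *)
have [s HQ] : exists s, 'X * Q^`() = 1 + 'X * Q - Q + s * 'X^M.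
  apply: poly_eq_modXn => -[|j] jM; rewrite coefXM coefB coefD coef1 coefXM /=.
    by rewrite coef_poly jM invr1 addr0 subrr.
  rewrite coef_deriv !coef_poly jM (ltnW jM) add0r -[_ *+ j.+1]mulr_natr.
  have f0 : j.+1`!%:R != 0 :> R by rewrite pnatr_eq0 -lt0n fact_gt0.
  rewrite (factS j.+1) natrM -(natr1 j.+1) invfM.
  have : j.+1%:R + 1 != 0 :> R by rewrite natr1 pnatr_eq0.
  by move: (j.+1`!%:R : R) (j.+1%:R : R) f0 => f a *; field; apply/andP.
(* Differentiating P Q = 1 and multiplying by X P gives X P' = - P^2 (X Q') modulo X^M. *)
have [t HP] : exists t, 'X * P^`() = P - P ^+ 2 - 'X * P + t * 'X^M.
  have := congr1 (fun p : {poly R} => P * ('X * p^`())) HPQ.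
  rewrite /= derivM derivD derivM derivXn -(polyC1 R) derivC => H.
  exists (P * ('X * r^`() + M%:R * r) - 'X * P^`() * r - P ^+ 2 * s + (P - 'X * P) * r).
  have e0 : 'X * (r * ('X^(M.-1) *+ M)) = M%:R * r * 'X^M.
    by rewrite -mulr_natl (exprS _ M.-1); ring.
  rewrite [LHS](_ : _ = P * ('X * (P^`() * Q + P * Q^`()))
    + 'X * P^`() * (1 - P * Q) - P ^+ 2 * ('X * Q^`())); last by ring.
  rewrite H HQ [X in 1 - X]HPQ.
  have -> : P * ('X * (0 + (r^`() * 'X^M + r * ('X^(M.-1) *+ M)))) =
    P * ('X * r^`()) * 'X^M + P * ('X * (r * ('X^(M.-1) *+ M))) by ring.
  rewrite e0.
  have -> : P ^+ 2 * (1 + 'X * Q - Q + s * 'X^M) =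
     P ^+ 2 + (P * Q) * ('X * P - P) + P ^+ 2 * s * 'X^M by ring.
  rewrite HPQ; ring.
have bP j : (j <= m)%N -> P`_j = b j by move=> jm; rewrite coef_poly ltnS jm.
have := congr1 (fun p : {poly R} => p`_m) HP.
rewrite coefD coefMXn ltnSn addr0 !coefB !coefXM expr2 coefM bP //.
under eq_bigr => j _ do rewrite (bP _ (ltn_ord j : (j <= m)%N)) (bP _ (leq_subr _ _)).
rewrite /M => H; move: H bP; move: {+}P => p; case: (m) => [|m'] H bP; first by move: H; rewrite /= mul0r.
by move: H; rewrite /= coef_deriv !bP // mulr_natl.
Qed.

(** In the Riccati relation at m >= 3 the terms j = 0 and j = m give 2 b_m, while those with j = 1
    and j = m - 1 give - b_(m-1), cancelling the linear term. The odd indices then drop out. *)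
Lemma bernoulli_euler {R : numFieldType} (b : nat -> R) :
  (forall m, \sum_(j < m.+1) b j / (m - j).+1`!%:R = (m == 0)%:R) ->
  forall n, (0 < n)%N -> (2 * n + 1)%:R * b (2 * n)%N =
    - (\sum_(1 <= j < n) b (2 * j)%N * b (2 * (n - j))%N) + (n == 1)%:R / 4.
Proof.
move=> bE.
have ric := bernoulli_riccati b bE.
have b0 : b 0 = 1 by have := bE 0; rewrite big_ord1 divr1.
have b1 : b 1 = - 2^-1.
  have := bE 1; rewrite !big_ord_recr big_ord0 /= b0 add0r mul1r divr1 addrC.
  by move=> /eqP; rewrite addr_eq0 => /eqP ->.
have big m : (m.+4)%:R * b m.+3 = - \sum_(2 <= i < m.+2) b i * b (m.+3 - i)%N.
  have := ric m.+3; rewrite -(big_mkord xpredT (fun j => b j * b (m.+3 - j)%N)).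
  rewrite big_nat_recr // big_nat_recr //= big_ltn // big_ltn //.
  rewrite subn0 subnn subSnn subn1 /= b0 b1 -(natr1 m.+3).
  by move=> H; rewrite mulrDl mul1r H; field.
(* In each product the indices are at least 2 and have odd sum, so one of them is odd, at least 3,
   and smaller than the sum. *)
have odd0 : forall n, (0 < n)%N -> b (2 * n).+1 = 0.
  move=> n; have [K] := ubnP n; elim: K n => // K IH [//|n] nK _.
  have -> : (2 * n.+1).+1 = (2 * n).+3 by lia.
  have n0 : (2 * n).+4%:R != 0 :> R by rewrite pnatr_eq0.
  apply: (mulfI n0); rewrite big mulr0 big1_seq ?oppr0 // => i /andP[_].
  rewrite mem_index_iota => /andP[i2 iN].
  have iE := odd_double_half i; case: (odd i) iE => /= iE.
    have -> : i = (2 * i./2).+1 by lia.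
    by rewrite IH ?mul0r //; lia.
  have -> : ((2 * n).+3 - i)%N = (2 * (n.+1 - i./2)).+1 by lia.
  by rewrite IH ?mulr0 //; lia.
have even_part (F : nat -> R) n : (forall j, (0 < j)%N -> F (2 * j).+1 = 0) ->
    \sum_(2 <= i < (2 * n).+1) F i = \sum_(1 <= j < n.+1) F (2 * j)%N.
  move=> F0; elim: n => [|n IHn]; first by rewrite !big_geq.
  rewrite (_ : (2 * n.+1).+1 = (2 * n).+3)%N; last by lia.
  rewrite big_nat_recr /=; last by lia.
  rewrite [RHS]big_nat_recr //= -IHn mulnS add2n; congr (_ + _).
  case: n {IHn} => [|n]; first by rewrite !big_geq.
  by rewrite big_nat_recr /= ?F0 ?addr0 //; lia.
case=> [//|[|n]] _.
  (* For m = 2 the terms j = 1 and j = m - 1 coincide, hence the extra 1/4. *)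
  rewrite big_geq // oppr0 add0r muln1 eqxx mul1r.
  have := ric 2; rewrite !big_ord_recr big_ord0 /= b0 b1 => H.
  have -> : (2 + 1)%:R * b 2 = 2 * b 2 + b 2 by ring.
  by rewrite H; field.
rewrite mul0r addr0 addn1.
have -> : (2 * n.+2)%N = (2 * n).+4 by lia.
rewrite big (_ : (2 * n).+3 = (2 * n.+1).+1); last by lia.
rewrite even_part => [|j j0].
  congr (- _); apply: eq_bigr => j _; congr (b _ * b _); lia.
by rewrite odd0 // mul0r.
Qed.

(** * From the analytic definition of the Bernoulli numbers to their convolution identity *)

Lemma poly_bounded_unit_ball {R : realType} (p : {poly R}) :
  exists2 S, 0 <= S & forall x, `|x| <= 1 -> `|p.[x]| <= S.
Proof.
exists (\sum_(i < size p) `|p`_i|) => [|x x1]; first by rewrite sumr_ge0.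
rewrite horner_coef (le_trans (ler_norm_sum _ _ _)) // ler_sum // => i _.
by rewrite normrM normrX ler_piMr // exprn_ile1.
Qed.

(** A nonzero constant coefficient would contradict the bound near 0; once it is 0, divide by x and
    lower M. *)
Lemma poly_small_coef0 {R : realType} (M : nat) (p : {poly R}) (d C : R) :
  0 < d -> (forall x, 0 < `|x| < d -> `|p.[x]| <= C * `|x| ^+ M) ->
  forall j, (j < M)%N -> p`_j = 0.
Proof.
move=> d0; elim: M p C => // M IHM p C pC.
have [q pE] : exists q : {poly R}, p = (p`_0)%:P + 'X * q.
  exists (drop_poly 1 p); rewrite -[LHS](poly_take_drop 1) expr1 mulrC.
  congr (_ + _); apply/polyP => -[|i]; rewrite coef_take_poly coefC //.
have [S S0 qS] := poly_bounded_unit_ball q.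
have C0 : 0 <= C.
  have := pC (d / 2); rewrite ger0_norm; last by rewrite divr_ge0 // ltW.
  have -> : 0 < d / 2 < d by apply/andP; split; lra.
  move=> /(_ isT) H; have := le_trans (normr_ge0 _) H.
  by rewrite pmulr_lge0 // exprn_gt0 // divr_gt0.
have p0E : p`_0 = 0.
  apply/eqP/negPn/negP => p0n.
  have a0 : 0 < `|p`_0| by rewrite normr_gt0.
  set a := `|p`_0| in a0.
  (* The three bounds keep x inside the disc, allow the bound [S] for q, and force a <= x (C + S +
     1) <= a / 2. *)
  pose x := Num.min (d / 2) (Num.min 1 (a / (2 * (C + S + 1)))).
  have D0 : 0 < C + S + 1 by lra.
  have x0 : 0 < x by rewrite !lt_min ltr01 !divr_gt0 // mulr_gt0.
  have xd : x <= d / 2 by rewrite ge_min lexx.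
  have x1 : x <= 1 by rewrite !ge_min lexx !orbT.
  have xa : x <= a / (2 * (C + S + 1)) by rewrite !ge_min lexx !orbT.
  have nx : `|x| = x by rewrite gtr0_norm.
  have B1 : `|p.[x]| <= C * x.
    have := pC x; rewrite nx (_ : 0 < x < d); last by apply/andP; split; lra.
    move=> /(_ isT)/le_trans; apply; rewrite ler_wpM2l // exprS.
    by rewrite ler_piMr ?exprn_ile1 // ltW.
  have B2 : `|q.[x]| <= S by apply: qS; rewrite nx.
  have : a <= C * x + x * S.
    have -> : a = `|p.[x] - x * q.[x]|.
      by rewrite [in RHS]pE !hornerE /a; congr `|_|; ring.
    by rewrite (le_trans (ler_normB _ _)) // lerD // normrM nx ler_wpM2l // ltW.
  move: xa; rewrite ler_pdivlMr ?mulr_gt0 // => xa H.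
  have : C * x + x * S <= x * (C + S + 1) by lra.
  lra.
have pX : p = 'X * q by rewrite {1}pE p0E add0r.
case=> [|j] jM //; rewrite pX coefXM /=.
apply: (IHM q C) => // x /andP[x0 xd].
have := pC x; rewrite x0 xd => /(_ isT).
by rewrite pX !hornerE normrM exprS mulrCA ler_pM2l.
Qed.

(** The terms at z are bounded by some K, so for |x| <= |z|/2 the tail is dominated by K (|x|/|z|)^M
    times a geometric series of ratio 1/2. *)
Lemma power_series_remainder {R : realType} (b : nat -> R) (z : R) (M : nat) :
  z != 0 -> cvgn (series (fun m => b m * z ^+ m)) ->
  exists2 C, 0 <= C & forall x l, `|x| <= `|z| / 2 ->
    series (fun m => b m * x ^+ m) @ \oo --> l ->
    `|l - \sum_(m < M) b m * x ^+ m| <= C * `|x| ^+ M.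
Proof.
move=> z0 /cvg_series_cvg_0/cvgP/cvg_seq_bounded[K0 [_ HK]].
pose K := Num.max (K0 + 1) 0.
have K_ge0 : 0 <= K by rewrite le_max lexx orbT.
have bK m : `|b m * z ^+ m| <= K.
  by rewrite le_max (HK (K0 + 1)) // ltrDl ltr01.
have nz : 0 < `|z| by rewrite normr_gt0.
exists (2 * K / `|z| ^+ M) => [|x l xz xl].
  by rewrite divr_ge0 ?mulr_ge0 // exprn_ge0.
set u := fun m => b m * x ^+ m.
have geom n : \sum_(0 <= k < n) (2^-1 : R) ^+ k = 2 - 2 * 2^-1 ^+ n.
  elim: n => [|n IHn]; first by rewrite big_geq // expr0; ring.
  by rewrite big_nat_recr //= IHn exprS; field.
have part n : `|series u (n + M)%N - \sum_(m < M) u m| <= 2 * K / `|z| ^+ M * `|x| ^+ M.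
  rewrite series_addn {1}/series /= big_mkord addrAC subrr add0r.
  rewrite (le_trans (ler_norm_sum _ _ _)) // -{1}[M]add0n big_addn addnK.
  apply: (@le_trans _ _ (\sum_(0 <= k < n) (K / `|z| ^+ M * `|x| ^+ M) * 2^-1 ^+ k)).
    rewrite ler_sum // => k _.
    have -> : `|u (k + M)%N| = `|b (k + M)%N * z ^+ (k + M)| * ((`|x| / `|z|) ^+ k * (`|x| / `|z|) ^+ M).
      rewrite /u !normrM !normrX -exprD expr_div_n; field.
      by rewrite expf_neq0 // gt_eqF.
    have -> : K / `|z| ^+ M * `|x| ^+ M * 2^-1 ^+ k = K * (2^-1 ^+ k * (`|x| / `|z|) ^+ M).
      by rewrite expr_div_n; ring.
    rewrite ler_pM ?mulr_ge0 ?exprn_ge0 ?divr_ge0 //.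
    rewrite ler_wpM2r ?exprn_ge0 ?divr_ge0 // lerXn2r ?nnegrE ?divr_ge0 //.
    by rewrite ler_pdivrMr // mulrC.
  rewrite -mulr_sumr geom.
  have -> : 2 * K / `|z| ^+ M * `|x| ^+ M = K / `|z| ^+ M * `|x| ^+ M * 2 by ring.
  rewrite ler_wpM2l ?mulr_ge0 ?invr_ge0 ?exprn_ge0 //.
  by rewrite lerBlDr lerDl mulr_ge0 // exprn_ge0.
apply: (cvgr_to_le (f := fun n => `|series u (n + M)%N - \sum_(m < M) u m|) (F := \oo)).
  by apply: cvg_norm; apply: cvgB; [rewrite cvg_shiftn | exact: cvg_cst].
by apply: nearW => n; exact: part.
Qed.

(* Truncations P of x/(e^x - 1) and Q of (e^x - 1)/x at order m satisfy
   P Q - 1 = O(x^(m+1)), so the coefficients of P Q - 1 up to x^m vanish. *)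
Lemma bernoulli_conv {R : realType} (B : nat -> R) : bernoulli_numbers B ->
  forall m, \sum_(j < m.+1) B j / j`!%:R / (m - j).+1`!%:R = (m == 0)%:R.
Proof.
rewrite /bernoulli_numbers near_withinE => /nbhs_ballP[e /= e0 He] m.
have {}He x : 0 < `|x| < e -> series (fun m => B m / m`!%:R * x ^+ m) @ \oo --> x / (expR x - 1).
  move=> /andP[x0 xe]; rewrite (_ : (fun _ => _) = fun m => B m * x ^+ m / m`!%:R).
    apply: He; last by rewrite -normr_gt0.
    by rewrite -ball_normE /ball_ /= sub0r normrN.
  by apply/funext => i; ring.
pose b m := B m / m`!%:R.
have e2 : 0 < e / 2 by rewrite divr_gt0.
have [C C0 HC] : exists2 C, 0 <= C & forall x l, `|x| <= `|e / 2| / 2 ->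
    series (fun m => b m * x ^+ m) @ \oo --> l ->
    `|l - \sum_(j < m.+1) b j * x ^+ j| <= C * `|x| ^+ m.+1.
  apply: power_series_remainder; first by rewrite gt_eqF.
  apply/cvg_ex; eexists; apply: He; rewrite gtr0_norm // e2 /=; lra.
have expE (x : R) : series (fun m => m`!%:R^-1 * x ^+ m) @ \oo --> expR x.
  rewrite (_ : (fun _ => _) = exp_coeff x); first exact: is_cvg_series_exp_coeff.
  by apply/funext => i; rewrite /exp_coeff /= mulrC.
(* One order further than for x/(e^x - 1), because a factor x is divided out of e^x - 1. *)
have [D D0 HD] : exists2 D, 0 <= D & forall x l, `|x| <= `|1 : R| / 2 ->
    series (fun m => m`!%:R^-1 * x ^+ m) @ \oo --> l ->
    `|l - \sum_(j < m.+2) j`!%:R^-1 * x ^+ j| <= D * `|x| ^+ m.+2.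
  apply: power_series_remainder; first by rewrite oner_eq0.
  by apply/cvg_ex; eexists; exact: expE.
pose P := \poly_(j < m.+1) b j; pose Q : {poly R} := \poly_(j < m.+1) j.+1`!%:R^-1.
have [SP SP0 HP] := poly_bounded_unit_ball P.
have [SQ SQ0 HQ] := poly_bounded_unit_ball Q.
pose d := Num.min (e / 4) (1 / 2).
have d0 : 0 < d by rewrite lt_min !divr_gt0.
have PQ x : 0 < `|x| < d -> `|(P * Q - 1).[x]| <= (SP * D + C * (SQ + D)) * `|x| ^+ m.+1.
  move=> /andP[x0]; rewrite lt_min => /andP[xe x1].
  have x_le1 : `|x| <= 1 by lra.
  have xe' : 0 < `|x| < e by rewrite x0 /=; lra.
  have := HC x _ _ (He x xe'); rewrite (gtr0_norm e2) => /(_ ltac:(lra)).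
  have := HD x _ _ (expE x); rewrite normr1 => /(_ (ltW x1)).
  have -> : \sum_(j < m.+1) b j * x ^+ j = P.[x] by rewrite horner_poly.
  have -> : \sum_(j < m.+2) j`!%:R^-1 * x ^+ j = 1 + x * Q.[x].
    rewrite big_ord_recl invr1 mul1r expr0 horner_poly mulr_sumr; congr (_ + _).
    by apply: eq_bigr => j _; rewrite exprS /=; ring.
  set eps := expR x - _; set del := _ - P.[x] => Heps Hdel.
  have xn0 : x != 0 by rewrite -normr_gt0.
  have en0 : expR x - 1 != 0.
    by rewrite subr_eq0 -[X in _ != X](@expR0 R) (inj_eq (@expR_inj R)).
  (* Expands x = (P + del) (x Q + eps), whose factors are x/(e^x - 1) and e^x - 1. *)
  have key : x * (P * Q - 1).[x] = - (P.[x] * eps + del * (x * Q.[x] + eps)).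
    rewrite /eps /del hornerD hornerN hornerM -(polyC1 R) hornerC.
    have -> : x * Q.[x] + (expR x - (1 + x * Q.[x])) = expR x - 1 by ring.
    by move: (expR x) en0 => y y1; field.
  rewrite -(ler_pM2l x0) -normrM key normrN (le_trans (ler_normD _ _)) //.
  have -> : `|x| * ((SP * D + C * (SQ + D)) * `|x| ^+ m.+1) =
    SP * (D * `|x| ^+ m.+2) + C * `|x| ^+ m.+1 * (`|x| * SQ + D * `|x|).
    by rewrite (exprS _ m.+1); ring.
  rewrite lerD // normrM.
    by rewrite ler_pM // HP.
  rewrite ler_pM // (le_trans (ler_normD _ _)) // lerD //.
    by rewrite normrM ler_wpM2l // HQ.
  by rewrite (le_trans Heps) // ler_wpM2l // exprS ler_piMr // exprn_ile1.
have := poly_small_coef0 _ _ _ _ d0 PQ m (ltnSn m).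
rewrite coefB coef1 coefM => /eqP; rewrite subr_eq0 => /eqP <-.
apply: eq_bigr => j _; have jm : (j <= m)%N := ltn_ord j.
by rewrite !coef_poly !ltnS jm leq_subr.
Qed.

(** * Euler's identity for even zeta values *)

Lemma cvgn_sum {R : realType} (I : Type) (r : seq I) (P : pred I)
    (u : I -> R^nat) (l : I -> R) :
  (forall i, P i -> u i @ \oo --> l i) ->
  (fun N => \sum_(i <- r | P i) u i N) @ \oo --> \sum_(i <- r | P i) l i.
Proof.
move=> ul; elim: r => [|i r IHr].
  by rewrite big_nil; under eq_fun do rewrite big_nil; exact: cvg_cst.
rewrite big_cons; under eq_fun do rewrite big_cons.
by case: ifP => // Pi; apply: cvgD => //; exact: ul.
Qed.

(** Written as a power sum in the variables a^-2, the form fed to [evsum]. *)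
Definition zsum {R : realType} (N j : nat) : R := \sum_(1 <= a < N.+1) a%:R ^- 2 ^+ j.

Definition evzeta {R : realType} (j : nat) : R := limn (fun N => zsum N j : R).

(** Increasing, and bounded by 2 - 1/N since 1/(N+1)^2 <= 1/N - 1/(N+1). *)
Lemma zsum_cvg {R : realType} (j : nat) : (0 < j)%N ->
  (fun N => zsum N j : R) @ \oo --> (evzeta j : R).
Proof.
move=> j0; apply: nondecreasing_is_cvgn.
  apply/nondecreasing_seqP => N; rewrite /zsum [leRHS]big_nat_recr //= lerDl.
  by rewrite exprn_ge0 // invr_ge0 exprn_ge0.
exists 2 => _ [N _ <-].
suff H : zsum N.+1 j <= 2 - N.+1%:R^-1 :> R.
  apply: le_trans (le_trans H _); last by rewrite gerBl invr_ge0.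
  by rewrite /zsum [leRHS]big_nat_recr //= lerDl exprn_ge0 // invr_ge0 exprn_ge0.
have H n : (0 < n)%N -> n%:R ^- 2 ^+ j <= n%:R ^- 2 :> R.
  move=> n0; case: j j0 => // j _; rewrite exprS ler_piMr ?invr_ge0 ?exprn_ge0 //.
  rewrite exprn_ile1 ?invr_ge0 ?exprn_ge0 // invf_le1 ?exprn_gt0 ?ltr0n //.
  by rewrite exprn_ege1 // ler1n.
rewrite /zsum; elim: N => [|N IHN].
  by rewrite big_nat1 expr1n invr1 expr1n; lra.
rewrite big_nat_recr //=; apply: (le_trans (lerD IHN (H N.+2 isT))).
rewrite -(natr1 N.+1); have N0 : 0 < N.+1%:R :> R by rewrite ltr0n.
move: (N.+1%:R : R) N0 => x x0; rewrite -subr_ge0.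
have -> : 2 - (x + 1)^-1 - (2 - x^-1 + (x + 1) ^- 2) = (x * (x + 1) ^+ 2)^-1.
  by field; apply/andP; split; lra.
by rewrite invr_ge0 mulr_ge0 // ?exprn_ge0 ?addr_ge0 // ltW.
Qed.

Local Notation harm := (series harmonic).

Lemma harmonic_sumS {R : realType} n : harm n.+1 = harm n + n.+1%:R^-1 :> R.
Proof. by rewrite /series /= big_nat_recr. Qed.

(* The term b = a contributes 0 because 0^-1 = 0. *)
Lemma inv_sqr_diff_sum {R : realType} (a N : nat) : (0 < a <= N)%N ->
  2 * a%:R * \sum_(1 <= b < N.+1) (b%:R ^+ 2 - a%:R ^+ 2)^-1
  = 3 / (2 * a%:R) - (harm (N + a)%N - harm (N - a)%N) :> R.
Proof.
move=> /andP[a0 aN].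
have a0R : a%:R != 0 :> R by rewrite pnatr_eq0 -lt0n.
(* Partial fractions: 2a/(b^2 - a^2) = - 1/(a - b) - 1/(a + b) for b < a. *)
have below M : (M < a)%N -> 2 * a%:R * \sum_(1 <= b < M.+1) (b%:R ^+ 2 - a%:R ^+ 2)^-1
  = harm (a - M.+1)%N - harm a.-1 - harm (M + a)%N + harm a :> R.
  elim: M => [|M IHM] Ma.
    by rewrite big_geq // mulr0 add0n subn1; ring.
  rewrite big_nat_recr //= mulrDr IHM ?(ltnW Ma) // addSn harmonic_sumS.
  rewrite (_ : a - M.+1 = (a - M.+2).+1)%N; last by lia.
  rewrite harmonic_sumS.
  have -> : (a - M.+2).+1%:R = a%:R - M.+1%:R :> R by rewrite -natrB ?(ltnW Ma) //; congr _%:R; lia.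
  have -> : (M + a).+1%:R = a%:R + M.+1%:R :> R by rewrite -natrD; congr _%:R; lia.
  have : a%:R - M.+1%:R != 0 :> R by rewrite -natrB ?(ltnW Ma) // pnatr_eq0; lia.
  have : a%:R + M.+1%:R != 0 :> R by rewrite -natrD pnatr_eq0; lia.
  move: (M.+1%:R : R) (a%:R : R) => m x xm1 xm2.
  suff -> : 2 * x * (m ^+ 2 - x ^+ 2)^-1 = - (x - m)^-1 - (x + m)^-1 by ring.
  have h : m ^+ 2 - x ^+ 2 != 0.
    by rewrite subr_sqr mulf_neq0 ?[m + x]addrC // -oppr_eq0 opprB.
  by field; rewrite h xm1 xm2.
have -> : N = (a + (N - a))%N by rewrite subnKC.
elim: (N - a)%N => [|d IHd]; last first.
  rewrite addnS big_nat_recr //= mulrDr IHd addSn harmonic_sumS.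
  rewrite (_ : ((a + d).+1 - a = (a + d - a).+1)%N); last by lia.
  rewrite harmonic_sumS (_ : a + d - a = d)%N; last by lia.
  have -> : (a + d + a).+1%:R = 2 * a%:R + d.+1%:R :> R by rewrite -natrM -natrD; congr _%:R; lia.
  have -> : (a + d).+1%:R = a%:R + d.+1%:R :> R by rewrite -natrD addnS.
  have : d.+1%:R != 0 :> R by rewrite pnatr_eq0.
  have : 2 * a%:R + d.+1%:R != 0 :> R by rewrite -natrM -natrD pnatr_eq0; lia.
  move: (d.+1%:R : R) (a%:R : R) a0R => m x x0 xm1 m0.
  suff -> : 2 * x * ((x + m) ^+ 2 - x ^+ 2)^-1 = m^-1 - (2 * x + m)^-1 by ring.
  have -> : (x + m) ^+ 2 - x ^+ 2 = m * (2 * x + m) by ring.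
  by field; rewrite m0 xm1.
(* At N = a, the constant 3/(2a) collects H_a - H_(a-1) = 1/a and H_(2a) - H_(2a-1) = 1/(2a). *)
rewrite addn0 big_nat_recr //= subrr invr0 addr0.
have -> : 2 * a%:R * (\sum_(1 <= b < a) (b%:R ^+ 2 - a%:R ^+ 2)^-1) =
   harm 0 - harm a.-1 - harm (a.-1 + a)%N + harm a :> R.
  by have := below a.-1; rewrite (prednK a0) subnn => ->.
have -> : (a + a = (a.-1 + a).+1)%N by lia.
rewrite harmonic_sumS subnn.
have -> : harm a = harm a.-1 + a%:R^-1 :> R by rewrite -{1}(prednK a0) harmonic_sumS prednK.
have -> : (a.-1 + a).+1%:R = 2 * a%:R :> R by rewrite -natrM; congr _%:R; lia.
by field.
Qed.

(** The difference has 2a terms, each at most 1/(N - a + 1). *)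
Lemma harmonic_window {R : realType} (a N : nat) : (a <= N)%N ->
  (0 : R) <= (harm (N + a)%N : R) - harm (N - a)%N <= 2 * a%:R / (N - a).+1%:R.
Proof.
move=> aN.
have -> : harm (N + a)%N - harm (N - a)%N = \sum_(N - a <= k < N + a) k.+1%:R^-1 :> R.
  rewrite (_ : (N + a = 2 * a + (N - a))%N); last by lia.
  by rewrite series_addn addrC addKr.
rewrite sumr_ge0 => [|k _]; last by rewrite invr_ge0.
apply: (@le_trans _ _ (\sum_(N - a <= k < N + a) (N - a).+1%:R^-1)).
  rewrite !big_nat ler_sum // => k /andP[Nk _].
  by rewrite lef_pV2 ?posrE ?ltr0n // ler_nat.
rewrite sumr_const_nat -[_ *+ _]mulr_natl (_ : N + a - (N - a) = 2 * a)%N; last by lia.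
by rewrite natrM.
Qed.

(** Finite geometric sum in x = a^-2 and y = b^-2, where x y / (x - y) = 1/(b^2 - a^2). For a = b
    the second summand is 0 and the first counts n - 1 equal terms. *)
Lemma geometric_pair_sum {R : realType} (a b n : nat) :
  (0 < a)%N -> (0 < b)%N -> (0 < n)%N ->
  \sum_(1 <= j < n) (a%:R ^- 2) ^+ j * (b%:R ^- 2) ^+ (n - j) =
  (a == b)%:R * (n.-1%:R * (a%:R ^- 2) ^+ n)
  + (b%:R ^+ 2 - a%:R ^+ 2)^-1 * ((a%:R ^- 2) ^+ n.-1 - (b%:R ^- 2) ^+ n.-1) :> R.
Proof.
move=> a0 b0 n0; have [<-|ab] := eqVneq a b.
  rewrite !subrr mulr0 addr0 mul1r big_nat.
  rewrite (eq_bigr (fun=> (a%:R ^- 2) ^+ n)) => [|j /andP[_ jn]].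
    by rewrite -big_nat sumr_const_nat subn1 mulr_natl.
  by rewrite -exprD subnKC // ltnW.
rewrite mul0r add0r.
have aR : a%:R != 0 :> R by rewrite pnatr_eq0 -lt0n.
have bR : b%:R != 0 :> R by rewrite pnatr_eq0 -lt0n.
have d0 : b%:R ^+ 2 - a%:R ^+ 2 != 0 :> R.
  by rewrite subr_eq0 -!natrX eqr_nat eqn_sqr eq_sym.
apply: (mulfI d0); rewrite mulVKf //.
have : (b%:R ^+ 2 - a%:R ^+ 2) * (a%:R ^- 2 * b%:R ^- 2) = a%:R ^- 2 - b%:R ^- 2 :> R.
  by field; rewrite aR bR.
move: (_ - _) (a%:R ^- 2) (b%:R ^- 2) => c x y cE.
case: n n0 => // n _ /=; elim: n => [|n IHn].
  by rewrite big_geq // mulr0 !expr0 subrr.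
rewrite big_nat_recr //= subSnn expr1 mulrDr.
rewrite (eq_big_nat _ _ (F2 := fun j => y * (x ^+ j * y ^+ (n.+1 - j)))); last first.
  by move=> j /andP[_ jn]; rewrite subSn ?(ltnW jn) // exprS; ring.
rewrite -mulr_sumr mulrCA IHn.
have -> : c * (x ^+ n.+1 * y) = x ^+ n * (x - y) by rewrite -cE exprS; ring.
by rewrite !exprS; ring.
Qed.

(* Truncating at N, the off-diagonal terms telescope through inv_sqr_diff_sum;
   the error is at most 4 (1 + 1/2 + ... + 1/(N+1)) / (N+1), a Cesaro mean
   of the harmonic sequence. *)
Lemma evzeta_euler {R : realType} (n : nat) : (1 < n)%N ->
  \sum_(1 <= j < n) evzeta j * evzeta (n - j) = (n%:R + 2^-1) * evzeta n :> R.
Proof.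
move=> n1.
pose D a b := (b%:R ^+ 2 - a%:R ^+ 2)^-1 : R.
pose err N := \sum_(1 <= a < N.+1) (a%:R ^- 2) ^+ n.-1 * (harm (N + a)%N - harm (N - a)%N) / a%:R : R.
have finite N : \sum_(1 <= j < n) zsum N j * zsum N (n - j) =
    (n%:R + 2^-1) * zsum N n - err N :> R.
  transitivity (\sum_(1 <= a < N.+1) \sum_(1 <= b < N.+1)
      \sum_(1 <= j < n) (a%:R ^- 2) ^+ j * (b%:R ^- 2) ^+ (n - j) : R).
    under [RHS]eq_bigr => a _ do rewrite exchange_big.
    rewrite [RHS]exchange_big /=; apply: eq_bigr => j _.
    by rewrite /zsum mulr_suml; apply: eq_bigr => a _; rewrite mulr_sumr.
  transitivity (\sum_(1 <= a < N.+1) \sum_(1 <= b < N.+1)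
     ((a == b)%:R * (n.-1%:R * (a%:R ^- 2) ^+ n)
  + D a b * ((a%:R ^- 2) ^+ n.-1 - (b%:R ^- 2) ^+ n.-1)) : R).
    apply: eq_big_nat => a /andP[a0 _]; apply: eq_big_nat => b /andP[b0 _].
    by rewrite geometric_pair_sum // (ltnW n1).
  transitivity (\sum_(1 <= a < N.+1) (n.-1%:R * (a%:R ^- 2) ^+ n
     + 2 * (a%:R ^- 2) ^+ n.-1 * \sum_(1 <= b < N.+1) D a b)).
    under eq_bigr => a _ do rewrite big_split /=.
    rewrite big_split [RHS]big_split /=; congr (_ + _).
      apply: eq_big_nat => a aN; rewrite (bigD1_seq a) ?mem_index_iota ?iota_uniq //=.
      rewrite eqxx mul1r big1 ?addr0 // => b ba.
      by rewrite eq_sym (negbTE ba) mul0r.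
    (* [D] is antisymmetric, so swapping a and b turns the b-part into a second copy of the
       a-part. *)
    transitivity (\sum_(1 <= a < N.+1) (\sum_(1 <= b < N.+1) D a b * (a%:R ^- 2) ^+ n.-1)
       + \sum_(1 <= a < N.+1) (\sum_(1 <= b < N.+1) D a b * (a%:R ^- 2) ^+ n.-1)).
      rewrite [X in _ = _ + X]exchange_big -!big_split /=; apply: eq_bigr => a _.
      rewrite -big_split; apply: eq_bigr => b _ /=.
      by rewrite /D -(opprB (b%:R ^+ 2)) invrN; ring.
    rewrite -big_split; apply: eq_bigr => a _ /=.
    by rewrite -mulr_suml; ring.
  rewrite /zsum /err mulr_sumr -sumrB; apply: eq_big_nat => a /andP[a0 aN].
  have aR : a%:R != 0 :> R by rewrite pnatr_eq0 -lt0n.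
  have := @inv_sqr_diff_sum R a N; rewrite a0 -ltnS aN => /(_ isT).
  rewrite -/(D a) => key.
  (* The 3/(2a) of [inv_sqr_diff_sum] contributes 3/2, which with the n - 1 from the diagonal makes
     n + 1/2. *)
  have -> : 2 * (a%:R ^- 2) ^+ n.-1 * (\sum_(1 <= b < N.+1) D a b) =
     (a%:R ^- 2) ^+ n.-1 / a%:R * (2 * a%:R * (\sum_(1 <= b < N.+1) D a b)) by field.
  rewrite key.
  have nE : n = n.-1.+1 by rewrite prednK // ltnW.
  rewrite {2 4 5}nE exprS -[n.-1.+1%:R]natr1.
  by field.
have err0 : err N @[N --> \oo] --> (0 : R).
  have up : (fun N => 4 * arithmetic_mean harmonic N) @ \oo --> (0 : R).
    rewrite -[0](mulr0 4); apply: cvgM; first exact: cvg_cst.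
    by apply: cesaro; exact: cvg_harmonic.
  apply: squeeze_cvgr (cvg_cst 0) up; apply: nearW => N; apply/andP; split.
    rewrite /err big_nat sumr_ge0 // => a /andP[a0 aN].
    have [/andP[h _]] := (@harmonic_window R a N aN).
    by rewrite !mulr_ge0 ?invr_ge0 ?exprn_ge0 // invr_ge0 exprn_ge0.
  (* Since n >= 2, a^(-2(n-1)) <= 1/a, so each term is at most 2/(a (N - a + 1)); partial fractions
     use a + (N - a + 1) = N + 1. *)
  apply: (@le_trans _ _ (\sum_(1 <= a < N.+1) 2 / N.+1%:R * (a%:R^-1 + (N - a).+1%:R^-1))).
    rewrite /err; rewrite !big_nat ler_sum // => a /andP[a0 aN].
    have [_ /andP[h0 h]] := (conj isT (@harmonic_window R a N aN)).
    have aR : 0 < a%:R :> R by rewrite ltr0n.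
    have a1 : 1 <= a%:R :> R by rewrite ler1n.
    have bR : 0 < (N - a).+1%:R :> R by rewrite ltr0n.
    have NE : N.+1%:R = a%:R + (N - a).+1%:R :> R.
      by rewrite -natrD addnS subnKC.
    have -> : 2 / N.+1%:R * (a%:R^-1 + (N - a).+1%:R^-1) =
        a%:R^-1 * (2 * a%:R / (N - a).+1%:R) / a%:R :> R.
      by rewrite NE; field; rewrite !gt_eqF // addr_gt0.
    rewrite ler_wpM2r ?invr_ge0 // ler_pM ?exprn_ge0 ?invr_ge0 ?exprn_ge0 //.
    have x1 : a%:R ^- 2 <= 1 :> R by rewrite invf_le1 ?exprn_gt0 // exprn_ege1.
    have -> : n.-1 = n.-2.+1 by case: (n) n1 => [|[]].
    rewrite exprS; apply: (@le_trans _ _ (a%:R ^- 2)).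
      by rewrite ler_piMr ?invr_ge0 ?exprn_ge0 // exprn_ile1 // invr_ge0 exprn_ge0.
    by rewrite lef_pV2 ?posrE ?exprn_gt0 // expr2 ler_pMr.
  have h1 : \sum_(1 <= a < N.+1) (N - a).+1%:R^-1 = harm N :> R.
    rewrite big_add1 /= big_nat_rev /= /series /= !big_nat; apply: eq_bigr => a /andP[_ aN].
    by congr (_%:R^-1); lia.
  have h2 : \sum_(1 <= a < N.+1) a%:R^-1 = harm N :> R by rewrite big_add1.
  rewrite -mulr_sumr big_split /= h1 h2 /arithmetic_mean /= harmonic_sumS.
  have -> : 2 / N.+1%:R * (harm N + harm N) = 4 * (N.+1%:R^-1 * harm N) :> R by ring.
  by rewrite ler_pM2l // ler_wpM2l ?invr_ge0 // lerDl invr_ge0.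
have L1 : (fun N => \sum_(1 <= j < n) zsum N j * zsum N (n - j)) @ \oo -->
    \sum_(1 <= j < n) (evzeta j * evzeta (n - j) : R).
  rewrite big_nat; under eq_fun do rewrite big_nat.
  by apply: cvgn_sum => j /andP[j0 jn]; apply: cvgM; apply: zsum_cvg; rewrite // subn_gt0.
have L2 : (fun N => \sum_(1 <= j < n) zsum N j * zsum N (n - j)) @ \oo -->
    ((n%:R + 2^-1) * evzeta n - 0 : R).
  under eq_fun do rewrite finite.
  by apply: cvgB err0; apply: cvgM; [exact: cvg_cst | apply: zsum_cvg; exact: ltnW].
by rewrite -(cvg_lim (@Rhausdorff R) L1) (cvg_lim (@Rhausdorff R) L2) subr0.
Qed.

(** * Even multiple zeta values as limits of symmetric functions *)

(** Splits on whether N occurs, in step with the recursion of [elem_sym]. *)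
Fixpoint decreasing_seqs (N k : nat) : seq (seq nat) :=
  match k, N with
  | 0, _ => [:: [::]]
  | _.+1, 0 => [::]
  | k'.+1, N'.+1 =>
      decreasing_seqs N' k'.+1 ++ [seq N :: l | l <- decreasing_seqs N' k']
  end.

Lemma mem_decreasing_seqs N k l : (l \in decreasing_seqs N k) =
  [&& size l == k, sorted gtn l & all (fun x => 0 < x <= N)%N l].
Proof.
have W n (s : seq nat) : all (fun x => 0 < x <= n)%N s -> all (fun x => 0 < x <= n.+1)%N s.
  by apply: sub_all => x /andP[-> /leqW].
elim: N k l => [|N IHN] [|k] l; try by case: l.
  case: l => //= x l; rewrite in_nil; case: (x) => [|y] /=; by rewrite !andbF.
rewrite [decreasing_seqs _ _]/= mem_cat IHN; apply/orP/and3P.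
  case=> [/and3P[sl dl /W al]|/mapP[l' + ->]]; first by [].
  rewrite IHN => /and3P[/eqP sl dl al]; split; first by rewrite /= sl.
    rewrite /= path_sortedE; last by move=> x y z /= h1 h2; exact: ltn_trans h2 h1.
    by rewrite dl andbT; apply: sub_all al => x /andP[].
  by rewrite /= leqnn W.
case: l => [[]//|x l] /= [sl pl /andP[/andP[x0 xN] al]].
move: pl; rewrite path_sortedE; last by move=> a b c /= h1 h2; exact: ltn_trans h2 h1.
move=> /andP[xl dl].
have al' m : (x <= m.+1)%N -> all (fun y => 0 < y <= m)%N l.
  move=> xm; apply/allP => y yl; have /andP[-> _] := allP al _ yl.
  by rewrite -ltnS (leq_trans _ xm) //; exact: (allP xl).
move: xN; rewrite leq_eqVlt => /orP[/eqP xE|xN]; [right|left].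
  rewrite xE mem_map; last by move=> ? ? [].
  by rewrite IHN -eqSS sl dl al' // xE.
by rewrite sl xl dl x0 -ltnS xN al' // ltnW.
Qed.

Lemma uniq_decreasing_seqs N k : uniq (decreasing_seqs N k).
Proof.
elim: N k => [|N IHN] [|k] //=; rewrite cat_uniq IHN map_inj_uniq ?IHN ?andbT /=; last first.
  by move=> ? ? [].
apply/hasPn => _ /mapP[l _ ->]; rewrite mem_decreasing_seqs /=.
by rewrite ltnn !andbF.
Qed.

Lemma sum_decreasing_seqs {A : nzRingType} (U : nat -> A) N k :
  \sum_(l <- decreasing_seqs N k) \prod_(x <- l) U x =
  elem_sym [seq U x | x <- rev (iota 1 N)] k.
Proof.
elim: N k => [|N IHN] [|k]; rewrite ?elem_sym0.
- by rewrite big_seq1 big_nil.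
- by rewrite big_nil.
- by rewrite big_seq1 big_nil.
have -> : rev (iota 1 N.+1) = N.+1 :: rev (iota 1 N).
  by rewrite -(addn1 N) iotaD rev_cat add1n addn1.
rewrite /= big_cat big_map /= -!IHN; congr (_ + _); rewrite mulr_sumr.
by apply: eq_bigr => l _; rewrite big_cons.
Qed.

Definition ffun_of_seq (k : nat) (l : seq nat) : {ffun 'I_k -> nat} :=
  [ffun a : 'I_k => nth 0%N l a].

Lemma mem_truncated_index (N k : nat) (f : {ffun 'I_k -> nat}) :
  (f \in map (ffun_of_seq k) (decreasing_seqs N k)) <->
  mzv_index k f /\ forall a, (f a <= N)%N.
Proof.
split.
  move=> /mapP[l + ->]; rewrite mem_decreasing_seqs => /and3P[/eqP sl dl /allP al].
  have inl (a : 'I_k) : nth 0%N l a \in l by rewrite mem_nth ?sl.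
  split; last by move=> a; rewrite ffunE; have /andP[] := al _ (inl a).
  split=> [a|a b ab]; rewrite !ffunE; first by have /andP[] := al _ (inl a).
  apply: (sorted_ltn_nth (leT := gtn)); rewrite ?inE ?sl //.
  by move=> x y z /= h1 h2; exact: ltn_trans h2 h1.
move=> [[f0 fdec] fN].
have nthf (a : 'I_k) : nth 0%N (codom f) a = f a by rewrite codom_ffun nth_fgraph_ord.
have sf : size (codom f) = k by rewrite size_codom card_ord.
apply/mapP; exists (codom f); last by apply/ffunP => a; rewrite ffunE nthf.
rewrite mem_decreasing_seqs sf eqxx /=; apply/andP; split.
  apply/(sortedP 0%N) => i; rewrite sf => ik.
  have := fdec (Ordinal (ltnW ik)) (Ordinal ik) (leqnn _).
  by rewrite -!nthf.
by apply/allP => _ /codomP[a ->]; rewrite f0 fN.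
Qed.

Lemma uniq_truncated_index (N k : nat) :
  uniq (map (ffun_of_seq k) (decreasing_seqs N k)).
Proof.
rewrite map_inj_in_uniq ?uniq_decreasing_seqs // => l l'.
rewrite !mem_decreasing_seqs => /and3P[/eqP sl _ _] /and3P[/eqP sl' _ _] ll'.
apply: (@eq_from_nth _ 0%N); rewrite sl ?sl' // => i ik.
by have := congr1 (fun f : {ffun 'I_k -> nat} => f (Ordinal ik)) ll'; rewrite !ffunE.
Qed.

(** The truncations n_1 <= N increase, and every finite set of indices lies in one of them. *)
Lemma esum_mzv_index {R : realType} (k : nat) (g : {ffun 'I_k -> nat} -> \bar R) :
  (forall f, 0 <= g f)%E ->
  (fun N => \sum_(l <- decreasing_seqs N k) g (ffun_of_seq k l))%E @ \oo -->
  (\esum_(f in mzv_index k) g f)%E.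
Proof.
move=> g0; set T := fun N => _.
have TE N : T N = (\sum_(f \in [set` map (ffun_of_seq k) (decreasing_seqs N k)]) g f)%E.
  by rewrite -fsbig_seq ?uniq_truncated_index // big_map.
have ndT : nondecreasing_seq T.
  apply/nondecreasing_seqP => N; rewrite /T; case: k g g0 T TE => [|k] g g0 _ _.
    by case: N.
  rewrite [decreasing_seqs N.+1 _]/= big_cat /= leeDl // sume_ge0 //.
have -> : (\esum_(f in mzv_index k) g f)%E = ereal_sup (range T).
  apply/eqP; rewrite eq_le; apply/andP; split.
    apply: ge_ereal_sup => _ [/= F [finF FI] <-].
    have [s FE] := (finite_seqP F).1 finF.
    pose N := \max_(f <- s) \max_(a < k) f a.
    apply: (@le_trans _ _ (T N)); last by apply: ereal_sup_ubound; exists N.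
    rewrite TE; apply: lee_fsum_nneg_subset => [//||f|f _]; [exact: finite_seq| |exact: g0].
    rewrite !inE => Ff; apply/mem_truncated_index; split; first exact: FI.
    move=> a; apply: (@leq_trans (\max_(a < k) f a)).
      exact: (leq_bigmax a).
    rewrite /N (big_rem f) ?leq_maxl //=.
    by move: Ff; rewrite FE.
  apply: ge_ereal_sup => _ [N _ <-]; rewrite TE.
  apply: ereal_sup_ubound; eexists; last reflexivity.
  by split; [exact: finite_seq | move=> f /= /mem_truncated_index[]].
exact: ereal_nondecreasing_cvgn.
Qed.

(** Reindexing by i = 2j, so that X records half the exponent. *)
Lemma geom_poly_even {R : realType} (n v : nat) :
  geom_poly n.+1 (v%:R ^- 2 : R) =
  \sum_(i < (2 * n).+1 | (0 < i)%N && ~~ odd i) (v%:R ^- i) *: 'X^(i./2).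
Proof.
rewrite /geom_poly poly_def.
rewrite -(big_mkord xpredT (fun j => (if j == 0%N then 0 else v%:R ^- 2 ^+ j) *: 'X^j)).
rewrite -(big_mkord (fun i => (0 < i)%N && ~~ odd i) (fun i => (v%:R ^- i : R) *: 'X^(i./2))).
elim: n => [|n IHn].
  by rewrite big_nat1 scale0r big_mkcond big_nat1.
rewrite big_nat_recr // IHn mulnS add2n [RHS]big_mkcond.
rewrite [RHS]big_nat_recr // [in RHS]big_nat_recr //= -[in RHS]big_mkcond.
rewrite oddM /= addr0; congr (_ + _ *: 'X^_); last by rewrite mul2n doubleK.
by rewrite exprVn -exprM mulnS add2n.
Qed.

(** Expanding the product chooses one even exponent per position; the coefficient of X^n selects
    total weight 2n. *)
Lemma even_exponents_sum {R : realType} (n k : nat) (f : 'I_k -> nat) :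
  \sum_(i : {ffun 'I_k -> 'I_(2 * n).+1} |
         [forall a, (0 < i a)%N && ~~ odd (i a)]
         && ((\sum_(a < k) i a)%N == (2 * n)%N))
    \prod_(a < k) ((f a)%:R ^- i a : R) =
  (\prod_(a < k) geom_poly n.+1 ((f a)%:R ^- 2 : R))`_n.
Proof.
under [in RHS]eq_bigr => a _ do rewrite geom_poly_even.
rewrite bigA_distr_big coef_sum /= [RHS]big_mkcond [LHS]big_mkcond.
apply: eq_bigr => i _.
have -> : (i \in ffun_on (fun j : 'I_(2 * n).+1 => (0 < j)%N && ~~ odd j)) =
   [forall a, (0 < i a)%N && ~~ odd (i a)].
  by apply/familyP/forallP.
case: forallP => //= iQ.
have -> : (\sum_(a < k) i a)%N = (2 * \sum_(a < k) (i a)./2)%N.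
  rewrite big_distrr /=; apply: eq_bigr => a _; have /andP[_ ia] := iQ a.
  by have := odd_double_half (i a); rewrite (negbTE ia) add0n -mul2n.
rewrite eqn_pmul2l // scaler_prod prodrXr coefZ coefXn [n == _]eq_sym.
by case: eqP; rewrite ?mulr1 ?mulr0.
Qed.

Lemma even_mzv_sum_esum {R : realType} (n k : nat) :
  even_mzv_sum R (2 * n) k =
  \esum_(f in mzv_index k)
    ((\prod_(a < k) geom_poly n.+1 ((f a)%:R ^- 2 : R))`_n)%:E.
Proof.
rewrite /even_mzv_sum /mzv -esum_sum; last first.
  by move=> f i _ _; rewrite lee_fin prodr_ge0 // => a _; rewrite invr_ge0 exprn_ge0.
by apply: eq_esum => f _; rewrite sumEFin even_exponents_sum.
Qed.

Lemma coef_sum_geom_poly {R : realType} (n N j : nat) : (j <= n)%N ->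
  (\sum_(u <- [seq geom_poly n.+1 (v%:R ^- 2 : R) | v <- rev (iota 1 N)]) u)`_j =
  if j == 0%N then 0 else zsum N j.
Proof.
move=> jn; rewrite big_map coef_sum (perm_big (iota 1 N)) ?perm_rev //=.
rewrite /zsum /index_iota subSS subn0.
under eq_bigr => v _ do rewrite coef_poly ltnS jn.
by case: (j == 0%N) => //; rewrite big1.
Qed.

Lemma eq_evsum {R : numFieldType} (p q : nat -> R) k n :
  (forall j, (j <= n)%N -> p j = q j) -> evsum p k n = evsum q k n.
Proof.
elim: k n => [//|k IHk] n pq; rewrite /= /log_op IHk //.
congr ((_ - _ + _) / _); apply: eq_bigr => j _.
rewrite (pq _ (ltn_ord j : (j <= n)%N)) IHk // => i ij.
by rewrite pq // (leq_trans ij) ?leq_subr.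
Qed.

(** For fixed k and n, [evsum] is a polynomial in p 0, ..., p n, hence continuous. *)
Lemma evsum_cvg {R : realType} (p : nat -> nat -> R) (q : nat -> R) k n :
  (forall j, (j <= n)%N -> p N j @[N --> \oo] --> q j) ->
  evsum (p N) k n @[N --> \oo] --> evsum q k n.
Proof.
elim: k n => [|k IHk] n pq; first exact: cvg_cst.
apply: cvgM; last exact: cvg_cst.
apply: cvgD; last by apply: cvgM; [exact: cvg_cst | exact: IHk].
apply: cvgB; last by apply: cvgM; [exact: cvg_cst | exact: IHk].
apply: cvgn_sum => j _; apply: cvgM; first exact: pq (ltn_ord j : (j <= n)%N).
by apply: IHk => i ij; apply: pq; rewrite (leq_trans ij) ?leq_subr.
Qed.

(* The value 0 at j = 0 makes evpsum the coefficients of \sum_(j >= 1) zeta(2j) t^j. *)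
Definition evpsum {R : realType} (j : nat) : R := if j == 0%N then 0 else evzeta j.

(** Restricted to n_1 <= N, the sum is the coefficient of t^n in e_k of the series t v^-2 / (1 - t
    v^-2), v <= N, that is, [evsum] of the truncated power sums; then N tends to infinity. *)
Lemma even_mzv_sumE {R : realType} (n k : nat) :
  even_mzv_sum R (2 * n) k = (evsum evpsum k n : R)%:E.
Proof.
rewrite even_mzv_sum_esum.
set g := fun f : {ffun 'I_k -> nat} => _%:E.
have g0 f : (0 <= g f)%E.
  rewrite /g lee_fin -even_exponents_sum sumr_ge0 // => i _.
  by rewrite prodr_ge0 // => a _; rewrite invr_ge0 exprn_ge0.
have := esum_mzv_index k g g0 => /(cvg_lim (@ereal_hausdorff R)) <-.
apply: (cvg_lim (@ereal_hausdorff R)).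
rewrite (_ : (fun _ => _) = EFin \o
   (fun N => evsum (fun j => if j == 0%N then 0 else zsum N j) k n)).
  apply: cvg_EFin; first by apply: nearW.
  apply: evsum_cvg => j jn; rewrite /evpsum; case: j jn => [|j] jn /=.
    exact: cvg_cst.
  exact: zsum_cvg.
apply/funext => N; rewrite /= /g sumEFin; congr (_%:E).
pose s := [seq geom_poly n.+1 (v%:R ^- 2 : R) | v <- rev (iota 1 N)].
transitivity ((elem_sym s k)`_n).
  rewrite /s -sum_decreasing_seqs coef_sum !big_seq; apply: eq_bigr => l.
  rewrite mem_decreasing_seqs => /and3P[/eqP sl _ _].
  rewrite (big_nth 0%N) sl big_mkord.
  by under eq_bigr => a _ do rewrite ffunE.
rewrite (elem_sym_evsum n.+1) //; last first.
  by move=> _ /mapP[v _ ->]; exact: geom_poly_deriv.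
by apply: eq_evsum => j jn; rewrite coef_sum_geom_poly.
Qed.

(** * Even zeta values, Bernoulli numbers and the final formula *)

Lemma zetaE {R : realType} (j : nat) : (0 < j)%N ->
  zeta R (2 * j) = (evzeta j : R)%:E.
Proof.
move=> j0; apply: (cvg_lim (@ereal_hausdorff R)).
(* The partial sums of [zeta] stop before N, those of [zsum] include N. *)
rewrite -(cvg_shiftn 1) (_ : [sequence _]_n = EFin \o (fun N => zsum N j)).
  by apply: cvg_EFin; [exact: nearW | exact: zsum_cvg].
apply/funext => N; rewrite /= sumEFin addn1 /zsum; congr (_%:E).
by apply: eq_bigr => a _; rewrite exprVn -exprM.
Qed.

Lemma evpsum_euler {R : realType} (n : nat) : (1 < n)%N ->
  \sum_(j < n.+1) evpsum j * evpsum (n - j)%N = (n%:R + 2^-1) * evpsum n :> R.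
Proof.
move=> n1; rewrite -(big_mkord xpredT (fun j => evpsum j * evpsum (n - j)%N : R)).
rewrite big_nat_recr // big_ltn 1?ltnW //= subnn /evpsum /= mul0r mulr0 add0r addr0.
rewrite (gtn_eqF (ltnW n1)) -evzeta_euler //; apply: eq_big_nat => j /andP[j0 jn].
by rewrite (gtn_eqF j0) subn_eq0 leqNgt jn.
Qed.

(** The term a = 1 is already 1. Positivity later yields B_2j != 0. *)
Lemma evzeta_gt0 {R : realType} (j : nat) : (0 < j)%N -> 0 < evzeta j :> R.
Proof.
move=> j0; apply: (@lt_le_trans _ _ 1) => //.
apply: (cvgr_to_ge (zsum_cvg j j0)); near=> N.
have N0 : (0 < N)%N by near: N; exact: nbhs_infty_ge.
rewrite /zsum big_ltn // expr1n invr1 expr1n lerDl sumr_ge0 //.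
Unshelve. all: by end_near. Qed.

(** Euler's formula, with -24 zeta(2) in place of -(2 pi)^2. Strong induction on the quadratic
    recurrence shared by both sides; B_2/2! = 1/12 fixes the scale at n = 1. *)
Lemma evzeta_bernoulli {R : realType} (B : nat -> R) : bernoulli_numbers B ->
  forall n, (0 < n)%N ->
  evzeta n = - (B (2 * n)%N / (2 * n)`!%:R * (- (24 * evzeta 1)) ^+ n / 2).
Proof.
move=> hB; set b := fun m => B m / m`!%:R.
have euler := bernoulli_euler b (bernoulli_conv B hB).
move=> n; rewrite -/(b (2 * n)%N); have [K] := ubnP n.
elim: K n => // K IHK [//|[|n]] nK _.
  have := euler 1 isT; rewrite big_geq // oppr0 add0r mul1r => H.
  have -> : b (2 * 1)%N = 4^-1 / 3 by rewrite -H; field.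
  by rewrite expr1; field.
have c0 : n.+2%:R + 2^-1 != 0 :> R by rewrite gt_eqF // addr_gt0 ?invr_gt0.
apply: (mulfI c0); rewrite -evzeta_euler //.
rewrite (eq_big_nat _ _ (F2 := fun j =>
  (- (24 * evzeta 1)) ^+ n.+2 / 4 * (b (2 * j)%N * b (2 * (n.+2 - j))%N))); last first.
  move=> j /andP[j0 jn]; rewrite (IHK j) ?(IHK (n.+2 - j)%N) //; [|lia|lia|lia].
  have -> : (- (24 * evzeta 1)) ^+ n.+2 = (- (24 * evzeta 1)) ^+ j * (- (24 * evzeta 1)) ^+ (n.+2 - j) :> R.
    by rewrite -exprD subnKC // ltnW.
  by field.
rewrite -mulr_sumr -[\sum_(_ <= _ < _) _]opprK.
have := euler n.+2 isT; rewrite mul0r addr0 => <-.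
rewrite natrD natrM.
by move: (b _) (_ ^+ _) (n.+2%:R : R) => x y z; field.
Qed.

Local Open Scope ereal_scope.

Theorem theorem1 (R : realType) (B : nat -> R) (hB : bernoulli_numbers B)
    (n k : nat) (hk : (1 <= k)%N) (hkn : (k <= n)%N) :
  even_mzv_sum R (2 * n) k =
    (1 / 2 ^+ (2 * (k - 1)) * 'C(2 * k - 1, k)%:R)%:E * zeta R (2 * n)
    - \sum_(1 <= j < ((k - 1) %/ 2).+1)
        (1 / (2 ^+ (2 * k - 3) * (2 * j + 1)%:R * B (2 * j)%N)
           * 'C(2 * k - 2 * j - 1, k)%:R)%:E
        * zeta R (2 * j) * zeta R (2 * n - 2 * j).
Proof.
have n0 : (0 < n)%N by apply: leq_trans hkn.
have jbound j : (j < ((k - 1) %/ 2).+1)%N -> (2 * j < k)%N by lia.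
have four : (4 = 2 ^+ 2 :> R)%R by rewrite -natrX.
rewrite even_mzv_sumE zetaE //.
rewrite (eq_big_nat _ _ (F2 := fun j =>
  (1 / (2 ^+ (2 * k - 3) * (2 * j + 1)%:R * B (2 * j)%N)
    * 'C(2 * k - 2 * j - 1, k)%:R * evzeta j * evzeta (n - j))%:E)); last first.
  move=> j /andP[j0 jk]; have nj : (0 < n - j)%N by have := jbound j jk; lia.
  by rewrite -(mulnBr 2%N n j) !zetaE.
rewrite sumEFin -EFinM -EFinB; congr (_%:E).
rewrite evsum_closed ?hk //; last exact: evpsum_euler.
rewrite -(big_mkord xpredT (fun j => evcoef (6 * evpsum 1) k j * evpsum (n - j)%N)%R).
(* Beyond j = floor((k-1)/2) one has 2k - 2j - 1 < k and the binomial is 0. *)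
rewrite (big_cat_nat (n := ((k - 1) %/ 2).+1)) //=; last by lia.
rewrite [X in (_ + X)%R]big1_seq ?addr0; last first.
  move=> j /andP[_]; rewrite mem_index_iota => /andP[j1 j2].
  by rewrite /evcoef bin_small ?mulr0 ?mul0r //; lia.
rewrite big_ltn // subn0 -sumrN; congr (_ + _)%R.
  rewrite /evcoef /evpsum (gtn_eqF n0) expr0 muln0 subn0 mul1r !(mulr1, mul1r).
  rewrite exprM -four.
  by congr (_ * _)%R; rewrite mulrC.
apply: eq_big_nat => j /andP[j0 jk]; have {}jk := jbound j jk.
have nj : (0 < n - j)%N by lia.
rewrite /evpsum (gtn_eqF nj) -mulNr; congr (_ * _)%R.
have := evzeta_gt0 (R := R) j j0.
rewrite (evzeta_bernoulli B hB j j0) => pos.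
(* Were B_2j zero, zeta(2j) would vanish. *)
have B0 : B (2 * j)%N != 0%R.
  by apply: contraTneq pos => ->; rewrite !mul0r oppr0 ltxx.
rewrite /evcoef (_ : 4 * (6 * evzeta 1) = 24 * evzeta 1)%R; last by ring.
have -> : (2 * j + 1)`! = ((2 * j + 1) * (2 * j)`!)%N by rewrite addn1 factS.
(* Here k > 2j >= 2, so 2k - 3 is a true difference. *)
have -> : (4 ^+ (k - 1) = 2 * 2 ^+ (2 * k - 3) :> R)%R.
  by rewrite -exprS four -exprM; congr (_ ^+ _)%R; lia.
rewrite natrM.
have f0 : (2 * j)`!%:R != 0%R :> R by rewrite pnatr_eq0 -lt0n fact_gt0.
have t0 : (2 ^+ (2 * k - 3) != 0 :> R)%R by rewrite expf_neq0 // pnatr_eq0.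
have s0 : (2 * j + 1)%:R != 0%R :> R by rewrite pnatr_eq0 addn1.
move: (B _) (_`!%:R : R)%R ((2 ^+ _) : R)%R ((2 * j + 1)%:R : R)%R B0 f0 t0 s0.
move=> b f t s b0 f0 t0 s0; field.
by rewrite b0 f0 t0 s0.
Qed.
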